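(* Let $f=x^{24}+x+t\in\mathbb{F}_2(t)[x]$ with roots $\beta_1,\ldots,\beta_{24}$ in a splitting field over $\mathbb{F}_2(t)$, let $V$ be the $\mathbb{F}_2$-span of $\beta_1,\ldots,\beta_{24}$, let $W$ be an $\mathbb{F}_2$-vector space with basis $w_1,\ldots,w_{24}$, and let $\psi:W\to V$ be the $\mathbb{F}_2$-linear map with $\psi(w_i)=\beta_i$ for all $i$. Then the kernel of $\psi$, regarded as a subspace of $(\mathbb{F}_2)^{24}$ via coordinates with respect to $w_1,\ldots,w_{24}$, is isomorphic (equivalent as a code) to the binary Golay code of length $24$.
   Context: A $2$-polynomial over a field $F$ of characteristic $2$ is a polynomial of the form $\sum_{i=0}^n a_i x^{2^i}\in F[x]$, and its $2$-degree is $n$ if $a_n\neq 0$. The minimal $2$-polynomial of a polynomial $f\in F[x]$ without repeated roots is the unique monic $2$-polynomial over $F$ of smallest $2$-degree that is divisible by $f$; its set of roots is the $\mathbb{F}_2$-span of the roots of $f$. Standing facts assumed (established by computer algebra): the polynomial $f=x^{24}+x+t$ is irreducible over $\mathbb{F}_2(t)$; its minimal $2$-polynomial over $\mathbb{F}_2(t)$ is $$L=x^{4096} + (t^{24} + t)x^{2048} + t^{128}x^{1024} + (t^{88} +t^{65})x^{512} + t^{16}x^{32} +t^9x^{16} + (t^{40} + t^{17})x^8 + x^2 + (t^{24} + t)x,$$ which has $2$-degree $12$; and the irreducible factors of $L$ over $\mathbb{F}_2(t)$ have degrees $1, 24, 276, 1771, 2024$. Nothing is assumed about the Galois group of $f$.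 The binary Golay code of length $24$ is the (extended) binary Golay code, the binary linear code of length $24$, dimension $12$ and minimum distance $8$, which is unique up to permutation of coordinates. *)

(* Defs.v *)
From HB Require Import structures.
From mathcomp Require Import all_boot all_order all_fingroup all_algebra all_field.

Set Implicit Arguments.
Unset Strict Implicit.
Unset Printing Implicit Defensive.

Import GRing.Theory.
Local Open Scope ring_scope.

Section TwoPolynomials.
Variable F : fieldType.
Implicit Types p q f : {poly F}.

Definition has_two_degree p n :=
  exists a : 'I_n.+1 -> F, a ord_max != 0 /\ p = \sum_i a i *: 'X^(2 ^ i).

Definition minimal_two_poly f p := exists n,
  [/\ p \is monic, has_two_degree p n, f %| p
    & forall q m, q \is monic -> has_two_degree q m -> f %| q -> (n <= m)%N].

(* The factors are listed with multiplicity. *)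
Definition irreducible_factor_degrees p (ds : seq nat) :=
  exists qs : seq {poly F},
    [/\ forall q, q \in qs -> irreducible_poly q,
        p %= \prod_(q <- qs) q & [seq (size q).-1 | q <- qs] = ds].

End TwoPolynomials.

Definition F2t : fieldType := {fraction {poly 'F_2}}.

Definition t : F2t := tofrac ('X : {poly 'F_2}).

Definition f24 : {poly F2t} := 'X^24 + 'X + t%:P.

(* The exponents of 'X are left as powers of 2 so as not to build large unary
   numerals: 2 ^ 12 = 4096, 2 ^ 11 = 2048, etc. *)
Definition L24 : {poly F2t} :=
  'X^(2 ^ 12) + (t ^+ 24 + t) *: 'X^(2 ^ 11) + t ^+ 128 *: 'X^(2 ^ 10)
  + (t ^+ 88 + t ^+ 65) *: 'X^(2 ^ 9) + t ^+ 16 *: 'X^(2 ^ 5)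
  + t ^+ 9 *: 'X^(2 ^ 4) + (t ^+ 40 + t ^+ 17) *: 'X^(2 ^ 3)
  + 'X^2 + (t ^+ 24 + t) *: 'X.

Section F2Span.

Lemma pchar2_ext (K : fieldExtType F2t) : 2 \in [pchar K].
Proof.
rewrite (rmorph_pchar (in_alg K)) // (rmorph_pchar (tofrac (R := {poly 'F_2}))) //.
by rewrite (rmorph_pchar (polyC (R := 'F_2))) // pchar_Fp.
Qed.

(* K with its structure of vector space over the prime field *)
Definition over_F2 (K : fieldExtType F2t) : lmodType 'F_2 :=
  pPrimeCharType (pchar2_ext K).

Variables (M : lmodType 'F_2) (n : nat) (b : 'I_n -> M).

Definition in_F2span : {pred M} :=
  [pred x | [exists c : {ffun 'I_n -> 'F_2}, x == \sum_i c i *: b i]].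

Lemma in_F2span_submod_closed : submod_closed in_F2span.
Proof.
split=> [|a x y /existsP[c /eqP->] /existsP[d /eqP->]]; apply/existsP.
  by exists [ffun=> 0]; rewrite big1 // => i _; rewrite ffunE scale0r.
exists [ffun i => a * c i + d i]; rewrite scaler_sumr -big_split /=.
by apply/eqP/eq_bigr => i _; rewrite ffunE scalerDl scalerA.
Qed.

HB.instance Definition _ :=
  GRing.isSubmodClosed.Build 'F_2 M in_F2span in_F2span_submod_closed.

Record F2span := MkF2span { F2span_val :> M; _ : F2span_val \in in_F2span }.

HB.instance Definition _ := [isSub for F2span_val].
HB.instance Definition _ := [Choice of F2span by <:].
HB.instance Definition _ := [SubChoice_isSubLmodule of F2span by <:].

End F2Span.

Section Codes.
Variable n : nat.

Definition code := {set 'rV['F_2]_n}.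

Definition code_equiv (C D : code) :=
  exists s : 'S_n, D = [set col_perm s c | c in C].

Definition hweight (v : 'rV['F_2]_n) := #|[set i | v 0 i != 0]|.

(* The kernel of g, in coordinates with respect to the family w. *)
Definition kernel_code (W M : lmodType 'F_2) (w : n.-tuple W)
    (g : {linear W -> M}) : code :=
  [set c : 'rV['F_2]_n | g (\sum_i c 0 i *: tnth w i) == 0].

End Codes.

(* The coefficients of 1 + X^2 + X^4 + X^5 + X^6 + X^10 + X^11, which generates
   the cyclic [23, 12, 7] Golay code. *)
Definition golay_coefs : seq nat := [:: 0; 2; 4; 5; 6; 10; 11]%N.

(* Column 23 is the parity check: every row has seven ones before it. *)
Definition golay_entry (i j : nat) : bool :=
  (j == 23) || (i <= j)%N && ((j - i)%N \in golay_coefs).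

Definition golay_gen : 'M['F_2]_(12, 24) :=
  \matrix_(i, j) (golay_entry i j)%:R.

Definition golay24 : code 24 := [set c | (c <= golay_gen)%MS].

Fixpoint bitseqs k : seq bitseq :=
  if k is k'.+1 then [seq b :: s | b <- [:: true; false], s <- bitseqs k']
  else [:: [::]].

Lemma mem_bitseqs s : s \in bitseqs (size s).
Proof.
elim: s => // b s IHs; apply/allpairsP.
by exists (b, s); split=> //; case: b.
Qed.

Definition golay_word (s : bitseq) (j : nat) : bool :=
  foldr addb false [seq nth false s i && golay_entry i j | i <- iota 0 12].

Definition golay_wt (s : bitseq) := count (golay_word s) (iota 0 24).

Lemma golay_wt_check :
  all (fun s => ~~ has id s || (8 <= golay_wt s)%N) (bitseqs 12).
Proof. vm_cast_no_check (erefl true). Qed.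

Lemma natF2 (a : 'F_2) : a = (a != 0)%:R.
Proof. by case: a => [[|[|]]] // ?; apply/val_inj. Qed.

Lemma addbF2 (a b : bool) : (a (+) b)%:R = a%:R + b%:R :> 'F_2.
Proof. by case: a b => [] []; apply/val_inj. Qed.

Lemma golay_wordE (u : 'rV['F_2]_12) (j : 'I_24) :
  (u *m golay_gen) 0 j =
    (golay_word [seq u 0 i != 0 | i <- enum 'I_12] j)%:R.
Proof.
rewrite /golay_word; set s := map _ (enum _).
transitivity (\sum_(i <- iota 0 12)
    (nth false s i && golay_entry i j)%:R : 'F_2); last first.
  by elim: (iota 0 12) => [|i r IHr] /=; rewrite ?big_nil // big_cons IHr addbF2.
rewrite mxE -[iota 0 12]/(index_iota 0 12) big_mkord; apply: eq_bigr => i _.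
rewrite mxE /s (nth_map i) ?size_enum_ord // nth_ord_enum {1}[u 0 i]natF2.
by rewrite -natrM mulnb.
Qed.

Lemma golay_hweight (u : 'rV['F_2]_12) :
  u != 0 -> (8 <= hweight (u *m golay_gen))%N.
Proof.
move=> nz_u; pose s := [seq u 0 i != 0 | i <- enum 'I_12].
have sz_s : size s = 12 by rewrite size_map size_enum_ord.
have := mem_bitseqs s; rewrite sz_s => /(allP golay_wt_check).
have -> /= : has id s.
  have /rV0Pn[i nz_i] := nz_u.
  by apply/hasP; exists (u 0 i != 0) => //; apply/mapP; exists i; rewrite ?mem_enum.
suff -> : hweight (u *m golay_gen) = golay_wt s by [].
rewrite /hweight cardsE /golay_wt -val_enum_ord count_map cardE size_filter.
rewrite enumT; apply: eq_count => j /=; rewrite unfold_in golay_wordE.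
by case: golay_word.
Qed.

Lemma golay24_dim : \rank golay_gen = 12.
Proof.
apply/eqP; rewrite -/(row_free golay_gen).
rewrite -kermx_eq0; apply/rowV0P => u /sub_kermxP uG0; apply/eqP.
apply: contraT => /golay_hweight; rewrite uG0 /hweight.
by rewrite (_ : [set i | _] = set0) ?cards0 //; apply/setP=> i; rewrite !inE mxE eqxx.
Qed.

Lemma golay24_min_dist :
  (forall c, c \in golay24 -> c != 0 -> (8 <= hweight c)%N) /\
  (exists2 c, c \in golay24 & hweight c = 8).
Proof.
split=> [c|].
  rewrite inE => /submxP[u ->]; case: (eqVneq u 0) => [->|/golay_hweight //].
  by rewrite mul0mx eqxx.
exists (row 0 golay_gen); first by rewrite inE row_sub.
rewrite /hweight cardsE cardE size_filter -enumT.
transitivity (count (golay_entry 0) (iota 0 24)); last by vm_compute.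
rewrite -val_enum_ord count_map; apply: eq_count => j /=.
by rewrite unfold_in !mxE; case: golay_entry.
Qed.

(* Main.v *)
(* Idea.  Specialize t to 0, where x^24 + x + t becomes x (x^23 - 1): a symmetric
   function argument shows that the roots beta_i can be matched with the roots
   0, 1, z, ..., z^22 of x^24 + x so that every F_2-linear relation between the
   beta_i specializes.  With z a root of the generator polynomial of the [23, 12, 7]
   cyclic Golay code, the relation code C, punctured at the coordinate of the
   root 0, is thus contained in that cyclic code; equality follows from
   dim C >= 12, as the beta_i lie in the 2^12 roots of L.  It remains to see that
   the punctured coordinate is the parity check, i.e. that C has no word of
   weight 7.  Since f is irreducible the Galois group acts transitively on the
   coordinates of C, so such a word could be moved to one which has a nonzero
   punctured coordinate, giving a word of weight 6 in the cyclic Golay code. *)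

Require Import Defs.
From HB Require Import structures.
From mathcomp Require Import all_boot all_order all_fingroup all_algebra all_field.
From mathcomp Require Import ring.
From mathcomp.multinomials Require Import mpoly.
Import GRing.Theory.
Local Open Scope ring_scope.

(** * Evaluation of symmetric polynomials at the roots of a polynomial *)

Lemma mmap_mesym n (R S : comNzRingType) (f : {rmorphism R -> S}) v k :
  mmap f v (mesym n R k) = (mesym n S k).@[v].
Proof.
rewrite /mesym !rmorph_sum; apply: eq_bigr => A _; rewrite !rmorph_prod.
by apply: eq_bigr => i _; rewrite /= mmapX mmap1U mevalXU.
Qed.

Lemma rmorph_mmap n (R S T : comNzRingType) (f : {rmorphism R -> S})
    (g : {rmorphism S -> T}) (v : 'I_n -> S) p :
  g (mmap f v p) = mmap (g \o f) (g \o v) p.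
Proof.
rewrite rmorph_sum; apply: eq_bigr => m _; rewrite rmorphM rmorph_prod.
by congr (_ * _); apply: eq_bigr => i _; rewrite rmorphXn.
Qed.

Lemma mmap_comp_mpoly n k (R S : comNzRingType) (f : {rmorphism R -> S}) v p
    (lq : n.-tuple {mpoly R[k]}) :
  mmap f v (p \mPo lq) = mmap f (fun i => mmap f v (tnth lq i)) p.
Proof.
rewrite comp_mpolyE rmorph_sum; apply: eq_bigr => m _ /=.
rewrite mmapZ rmorph_prod; congr (_ * _).
by apply: eq_bigr => i _; rewrite rmorphXn.
Qed.

Lemma mmap_msym n (R S : comNzRingType) (f : {rmorphism R -> S}) v s
    (p : {mpoly R[n]}) :
  mmap f v (msym s p) = mmap f (v \o s) p.
Proof.
rewrite /msym {2}/mmap rmorph_sum; apply: eq_bigr => m _.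
rewrite rmorphM /= mmapC rmorph_prod; congr (_ * _).
by apply: eq_bigr => i _; rewrite rmorphXn /= mmapX mmap1U.
Qed.

Lemma eq_mmap n (R S : nzRingType) (f g : R -> S) (v w : 'I_n -> S) p :
  f =1 g -> v =1 w -> mmap f v p = mmap g w p.
Proof.
move=> fg vw; apply: eq_bigr => m _; rewrite fg; congr (_ * _).
by apply: eq_bigr => i _; rewrite vw.
Qed.

(** Vieta's formula, with the sign put on the coefficient so that the value is visibly in the image
    of [f]. *)
Lemma mesym_roots n (R : comNzRingType) (K : idomainType)
    (f : {rmorphism R -> K}) F (v : 'I_n -> K) (i : 'I_n) :
    map_poly f F = \prod_i ('X - (v i)%:P) ->
  (mesym n K i.+1).@[v] = f ((-1) ^+ i.+1 * F`_(n - i.+1)).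
Proof.
move=> Ff; rewrite rmorphM rmorph_sign -coef_map Ff.
have lt_i : (i.+1 < n.+1)%N by rewrite ltnS.
have := mroots_coeff [tuple v i | i < n] (Ordinal lt_i); rewrite big_map.
rewrite /= big_enum /= => ->; rewrite signrMK.
by apply: eq_mmap => // j; rewrite tnth_mktuple.
Qed.

(* The product over [s] of the [s]-conjugates of [\sum_j 'X^j *: P_j], with 'X a
   new indeterminate, is symmetric, so it is a polynomial in the coefficients
   of [F]: it vanishes at [w] because it vanishes at [v], hence so does one of
   its factors. *)
Lemma specialize_roots n (R : comNzRingType) (K L : idomainType)
    (f : {rmorphism R -> K}) (g : {rmorphism R -> L}) (F : {poly R})
    (v : 'I_n -> K) (w : 'I_n -> L) (P : seq {mpoly R[n]}) :
    injective f ->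
    map_poly f F = \prod_i ('X - (v i)%:P) ->
    map_poly g F = \prod_i ('X - (w i)%:P) ->
    {in P, forall p, mmap f v p = 0} ->
  exists s : 'S_n, {in P, forall p, mmap g (w \o s) p = 0}.
Proof.
move=> f_inj Ff Fg P0.
pose q := \sum_(j < size P) 'X^j *: map_mpoly polyC P`_j.
pose N := \prod_(s : 'S_n) msym s q.
have eval_q (S : idomainType) (h : {rmorphism R -> S}) (u : 'I_n -> S) :
    mmap (map_poly h) (polyC \o u) q =
    \poly_(j < size P) mmap h u P`_j.
  rewrite /q rmorph_sum poly_def; apply: eq_bigr => j _ /=.
  rewrite mmapZ /= map_polyXn mulrC -mul_polyC; congr (_ * _).
  rewrite rmorph_mmap {2}/mmap /= /map_mpoly /= {1}/mmap rmorph_sum /=.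
  apply: eq_bigr => m _; rewrite rmorphM /= mmapC /= map_polyC /= rmorph_prod.
  by congr (_ * _); apply: eq_bigr => i _; rewrite rmorphXn /= mmapX mmap1U.
have [e DN] : {e | N = e \mPo [tuple mesym n {poly R} i.+1 | i < n]}.
  have /sym_fundamental[e [<- _]] : N \is symmetric; last by exists e.
  apply/issymP => s; rewrite /N rmorph_prod.
  rewrite [RHS](reindex_inj (mulIg s)); apply: eq_bigr => r _ /=.
  by rewrite msymMm.
(* By Vieta, the images of [c] under [f] and [g] are the values of [N] at [v] and [w]. *)
pose c := e.@[fun i => ((-1) ^+ i.+1 * F`_(n - i.+1))%:P].
have eval_N (S : idomainType) (h : {rmorphism R -> S}) (u : 'I_n -> S) :
    map_poly h F = \prod_i ('X - (u i)%:P) ->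
    mmap (map_poly h) (polyC \o u) N = map_poly h c.
  move=> Fh; rewrite DN mmap_comp_mpoly /c /meval rmorph_mmap.
  apply: eq_mmap => // i; rewrite tnth_mktuple mmap_mesym /= map_polyC /=.
  rewrite -(mesym_roots _ _ _ _ _ _ i Fh) /meval rmorph_mmap.
  by rewrite -[LHS](mmap_mesym _ S _ (polyC \o idfun)).
have c0 : c = 0.
  apply: (map_inj_poly f_inj (rmorph0 f)); rewrite rmorph0 -(eval_N _ _ _ Ff).
  rewrite rmorph_prod (bigD1 1%g) //= msym1m eval_q.
  rewrite [X in X * _](_ : _ = 0) ?mul0r //; apply/polyP => j.
  by rewrite coef_poly coef0; case: ifP => // /(mem_nth 0)/P0.
have := eval_N _ g w Fg; rewrite c0 rmorph0 rmorph_prod => /eqP/prodf_eq0[s _].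
rewrite /= mmap_msym (eq_mmap _ _ _ _ _ _ (polyC \o (w \o s)) _ (frefl _)) //.
rewrite eval_q => /eqP/polyP p0; exists s => p /(nthP 0)[j lt_j <-].
by have := p0 j; rewrite coef_poly lt_j coef0.
Qed.

(** * The generator polynomial of the cyclic Golay code and its roots *)

Definition golay_poly : {poly 'F_2} :=
  \poly_(k < 12) (k \in golay_coefs)%:R.

Lemma size_golay_poly : size golay_poly = 12.
Proof. by apply: size_poly_eq. Qed.

Lemma coef_golay_poly k : golay_poly`_k = (k \in golay_coefs)%:R.
Proof.
rewrite coef_poly; case: ltnP => // le12k.
rewrite (_ : k \in golay_coefs = false) //; apply/negP => k_g.
have := allP (isT : all (fun k => k < 12)%N golay_coefs) k k_g.
by rewrite ltnNge le12k.
Qed.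

Lemma golay_entryE i j :
  (j < 23)%N ->
  (golay_entry i j)%:R = if (i <= j)%N then golay_poly`_(j - i) else 0 :> 'F_2.
Proof.
by move=> ltj; rewrite /golay_entry ltn_eqF // coef_golay_poly; case: leqP.
Qed.

(** Apart from the parity column, row [i] is [golay_poly] shifted by [i], so encoding is
    multiplication of polynomials. *)
Lemma golay_gen_coef (u : 'rV['F_2]_12) (j : 'I_24) :
  (j < 23)%N -> (u *m golay_gen) 0 j = (rVpoly u * golay_poly)`_j.
Proof.
move=> ltj; rewrite mxE [rVpoly u]poly_def mulr_suml coef_sum.
apply: eq_bigr => i _; rewrite insubT // => lt_i12.
rewrite mxE golay_entryE // -scalerAl coefZ coefXnM ltnNge if_neg.
by rewrite (_ : Sub _ _ = i) //; apply/val_inj.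
Qed.

Section GolayRoot.
Variables (L : fieldType) (h : {rmorphism 'F_2 -> L}) (z : L).
Hypothesis gz0 : root (map_poly h golay_poly) z.

Lemma pchar2_over_F2 : 2 \in [pchar L].
Proof. by rewrite (rmorph_pchar h) // pchar_Fp. Qed.

Lemma addrr_over_F2 (x : L) : x + x = 0.
Proof. exact: addrr_pchar2 pchar2_over_F2 x. Qed.

Lemma golay_root_eq :
  1 + z ^+ 2 + z ^+ 4 + z ^+ 5 + z ^+ 6 + z ^+ 10 + z ^+ 11 = 0.
Proof.
have/eqP <- := gz0; rewrite horner_coef size_map_poly size_golay_poly.
do 12! rewrite big_ord_recl; rewrite big_ord0 !coef_map /= !coef_golay_poly /=.
by rewrite !rmorph1 !rmorph0; ring.
Qed.

Lemma golay_root_prim : 23.-primitive_root z.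
Proof.
have g0 := golay_root_eq.
have z23 : z ^+ 23 = 1.
  apply/eqP; rewrite -subr_eq0; apply/eqP.
  (* Over the integers, [X^23 - 1 = (X - 1) g c - 2 e]. *)
  pose c := 1 + z + z ^+ 5 + z ^+ 6 + z ^+ 7 + z ^+ 9 + z ^+ 11.
  pose e := - z ^+ 5 + z ^+ 8 - z ^+ 9 - 2 * z ^+ 11 + 2 * z ^+ 12
    + z ^+ 14 - z ^+ 15 + z ^+ 18.
  transitivity ((1 + z ^+ 2 + z ^+ 4 + z ^+ 5 + z ^+ 6 + z ^+ 10 + z ^+ 11)
    * ((z - 1) * c) - (e + e)); first by rewrite /c /e; ring.
  by rewrite g0 addrr_over_F2 mul0r subr0.
have [m prim_m] := prim_order_exists (isT : (0 < 23)%N) z23.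
(* 23 is prime, so the order is 1 or 23; at [z = 1] the seven terms of [golay_root_eq] add up to
   1. *)
rewrite dvdn_divisors //= !inE => /orP[] /eqP Dm.
  move: prim_m g0; rewrite Dm => /prim_expr_order; rewrite expr1 => ->.
  rewrite !expr1n; do 3! rewrite addrr_over_F2 add0r.
  by move/eqP; rewrite oner_eq0.
by move: prim_m; rewrite Dm.
Qed.

(** The root 0 takes the last place, that of the parity check. *)
Lemma map_X24_X_golay :
  map_poly h ('X^24 + 'X) =
    \prod_(i < 24) ('X - (if (i < 23)%N then z ^+ i else 0)%:P).
Proof.
rewrite rmorphD /= map_polyXn map_polyX.
rewrite big_ord_recr /= subr0.
rewrite (eq_bigr (fun i : 'I_23 => 'X - (z ^+ i)%:P)) => [|i _]; last first.
  by rewrite ltn_ord.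
rewrite -(big_mkord xpredT (fun i => 'X - (z ^+ i)%:P)).
rewrite (factor_Xn_sub_1 golay_root_prim) mulrBl mul1r -exprSr.
congr (_ + _); apply/eqP; rewrite -subr_eq0 opprK.
by apply/eqP/polyP => k; rewrite coef0 coefD addrr_over_F2.
Qed.

(** Frobenius fixes the coefficients of [p]. *)
Lemma F2poly_root_sqr (p : {poly 'F_2}) x :
  root (map_poly h p) x -> root (map_poly h p) (x ^+ 2).
Proof.
have ch2 := pchar2_over_F2; move=> /eqP px0; apply/eqP.
transitivity (pFrobenius_aut ch2 (map_poly h p).[x]).
  2: by rewrite px0 rmorph0.
rewrite -(pFrobenius_autE ch2) !horner_coef rmorph_sum.
apply: eq_bigr => i _; rewrite rmorphM rmorphXn; congr (_ * _).
rewrite coef_map /= pFrobenius_autE -rmorphXn; congr (h _).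
by case: p`_i => [[|[|]]] // ?; apply/val_inj.
Qed.

Lemma golay_root_annihilator (p : {poly 'F_2}) :
  p != 0 -> root (map_poly h p) z -> (11 < size p)%N.
Proof.
move=> nz_p pz0; rewrite -(size_map_poly h).
(* The roots of [p] are stable under squaring; the orbit of [z] has length 11. *)
pose ks := [:: 1; 2; 4; 8; 16; 9; 18; 13; 3; 6; 12]%N.
suff: (size [seq z ^+ k | k <- ks] < size (map_poly h p))%N.
  by rewrite size_map.
have zM k : z ^+ k = z ^+ (k %% 23).
  by rewrite (prim_expr_mod golay_root_prim).
have pzX k :
    root (map_poly h p) (z ^+ k) -> root (map_poly h p) (z ^+ (k * 2 %% 23)).
  by rewrite -zM exprM; apply: F2poly_root_sqr.
apply: max_poly_roots; first by rewrite map_poly_eq0.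
  have p1 : root (map_poly h p) (z ^+ 1) by [].
  have p2 := pzX _ p1; have p4 := pzX _ p2; have p8 := pzX _ p4.
  have p16 := pzX _ p8; have p9 := pzX _ p16; have p18 := pzX _ p9.
  have p13 := pzX _ p18; have p3 := pzX _ p13; have p6 := pzX _ p3.
  have p12 := pzX _ p6.
  by rewrite /= ?(p1, p2, p4, p8, p16, p9, p18, p13, p3, p6, p12).
have ks23 : {in ks, forall k, k < 23}%N by apply/allP.
rewrite map_inj_in_uniq // => i j /ks23 lti /ks23 ltj /eqP.
by rewrite (eq_prim_root_expr golay_root_prim) !modn_small // => /eqP.
Qed.

(** The remainder modulo [golay_poly] also vanishes at [z], and by [golay_root_annihilator] it is
    too short to be nonzero. *)
Lemma golay_poly_dvdp (p : {poly 'F_2}) :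
  root (map_poly h p) z -> golay_poly %| p.
Proof.
move=> pz0; apply: contraT => nz_r.
have: (11 < size (p %% golay_poly)%R)%N.
  apply: golay_root_annihilator => //; move: pz0.
  by rewrite {1}(divp_eq p golay_poly) rmorphD rmorphM /root hornerD hornerM
             (eqP gz0) mulr0 add0r.
have := ltn_modp p golay_poly; rewrite -size_poly_eq0 size_golay_poly /=.
by rewrite ltnNge => /negP.
Qed.

(** The first 23 coordinates of [d] form a polynomial of degree at most 22 that vanishes at [z]; its
    quotient by [golay_poly] is the message [u]. The last coordinate multiplies the root 0 and stays
    free. *)
Lemma golay_root_relation (d : 'rV['F_2]_24) :
    \sum_(j < 24) h (d 0 j) * (if (j < 23)%N then z ^+ j else 0) = 0 ->
  exists u : 'rV['F_2]_12,
    forall j : 'I_24, (j < 23)%N -> d 0 j = (u *m golay_gen) 0 j.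
Proof.
pose p := \poly_(j < 23) d 0 (inord j).
move=> d0; have /golay_poly_dvdp g_p : root (map_poly h p) z.
  rewrite /root -[X in _ == X]d0 big_ord_recr /= mulr0 addr0.
  rewrite (horner_coef_wide (n := 23)); last by rewrite size_map_poly size_poly.
  apply/eqP/eq_bigr => j _; rewrite ltn_ord coef_map coef_poly ltn_ord.
  by congr (h (d 0 _) * _); apply/val_inj; rewrite /= inordK // ltnS ltnW.
exists (poly_rV (p %/ golay_poly)) => j ltj.
rewrite golay_gen_coef // poly_rV_K ?divpK //.
  by rewrite coef_poly ltj inord_val.
by rewrite size_divp -?size_poly_eq0 size_golay_poly // leq_subLR size_poly.
Qed.

End GolayRoot.

Lemma golay_root_exists :
  exists (L : fieldExtType 'F_2) (z : L),
    root (map_poly (in_alg L) golay_poly) z.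
Proof.
have nz_g : golay_poly != 0 by rewrite -size_poly_eq0 size_golay_poly.
have [L [[|z r] Dg _]] := FinSplittingFieldFor nz_g.
  have /eqP := eqp_size Dg.
  by rewrite big_nil size_poly1 size_map_poly size_golay_poly.
exists L, z; rewrite (eqp_root Dg) root_prod_XsubC inE eqxx //.
Qed.

(** * Weights, and codes with a transitive permutation group *)

Lemma hweight_col_perm n (s : 'S_n) (c : 'rV_n) :
  hweight (col_perm s c) = hweight c.
Proof.
rewrite /hweight -(card_imset _ (@perm_inj _ s)); congr #|pred_of_set _|.
apply/setP => j; apply/imsetP/idP => [[i]|]; rewrite !inE ?mxE.
  by move=> nz_ci ->.
by move=> nz_cj; exists (s^-1 j)%g; rewrite ?permKV // inE mxE permKV.
Qed.

Lemma hweight_golay_row i : hweight (row i golay_gen) = 8%N.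
Proof.
transitivity (count (golay_entry i) (iota 0 24)).
  rewrite /hweight cardsE cardE size_filter -enumT -val_enum_ord count_map.
  by apply: eq_count => j /=; rewrite unfold_in !mxE; case: golay_entry.
have wt8 : all (fun k => count (golay_entry k) (iota 0 24) == 8) (iota 0 12).
  by vm_compute.
by apply/eqP; apply: (allP wt8 i); rewrite mem_iota /=.
Qed.

Lemma ge_ord_max n (i : 'I_n.+1) : (n <= i)%N -> i = ord_max.
Proof.
by move=> le_ni; apply/val_inj/anti_leq; rewrite /= le_ni -ltnS ltn_ord.
Qed.

Section TransitiveCode.
Variable C : code 24.
Hypothesis C_ge : (2 ^ 12 <= #|C|)%N.
Hypothesis CB : forall c d, c \in C -> d \in C -> c - d \in C.
Hypothesis C_golay : forall c, c \in C ->
  exists u : 'rV['F_2]_12,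
    forall j : 'I_24, (j < 23)%N -> c 0 j = (u *m golay_gen) 0 j.
Hypothesis C_trans : forall i j : 'I_24,
  exists s : 'S_24, s i = j /\ {in C, forall c, col_perm s c \in C}.

(** A nonzero word supported at the last coordinate could be moved to coordinate 0, which would give
    a nonzero Golay word of weight at most 2. *)
Lemma last_coord_inj c :
  c \in C -> (forall j : 'I_24, (j < 23)%N -> c 0 j = 0) -> c = 0.
Proof.
move=> Cc c0; apply/rowP => j; rewrite mxE.
have [/c0 // | le23j] := ltnP j 23.
rewrite (ge_ord_max _ j le23j).
apply/eqP; apply: contraT => nz_c.
have [s [s0 Cs]] := C_trans ord0 ord_max.
have [u Du] := C_golay _ (Cs _ Cc).
have := Du ord0 isT; rewrite mxE s0 => Du0.
have /golay_hweight wt_ge8 : u != 0.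
  by apply: contraNneq nz_c => u0; rewrite Du0 u0 mul0mx mxE.
suff /(leq_trans wt_ge8) :
    (hweight (u *m golay_gen) <= #|[set ord0; ord_max : 'I_24]|)%N.
  by rewrite cards2.
apply: subset_leq_card.
apply/subsetP => k; rewrite !inE => nz_k.
have [ltk | le23k] := ltnP k 23; last first.
  by rewrite (ge_ord_max _ k le23k) eqxx orbT.
move: nz_k; rewrite -Du // mxE.
have [lt_sk | le23sk] := ltnP (s k) 23; first by rewrite c0 ?eqxx.
move=> _; apply/orP; left; rewrite -(inj_eq (@perm_inj _ s)) s0.
by rewrite (ge_ord_max _ _ le23sk).
Qed.

(* Moving a nonzero coordinate of [c] to the last place, where it is
   punctured, a word of weight at most 7 would give a word of weight at most 6
   of the punctured Golay code. *)
Lemma transitive_code_hweight c : c \in C -> c != 0 -> (8 <= hweight c)%N.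
Proof.
move=> Cc /rV0Pn[i nz_ci].
have [s [s23 Cs]] := C_trans ord_max i.
rewrite -(hweight_col_perm _ s); have := Cs c Cc; set d := col_perm s c => Cd.
have nz_d : d 0 ord_max != 0 by rewrite mxE s23.
have [u Du] := C_golay d Cd.
have /golay_hweight/leq_trans-> // : u != 0.
  apply: contraNneq nz_d => u0; rewrite (last_coord_inj d Cd) ?mxE // => j /Du ->.
  by rewrite u0 mul0mx mxE.
(* The last coordinate escapes [Du], but there [d] is nonzero. *)
apply/subset_leq_card/subsetP => j; rewrite !inE.
have [/Du -> // | le23j _] := ltnP j 23.
by rewrite (ge_ord_max _ j le23j).
Qed.

(** A count: sending a word of [C] to its message is injective by [last_coord_inj], and [C] has at
    least as many words as there are messages. *)
Lemma transitive_code_lift (u : 'rV['F_2]_12) :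
  exists2 c, c \in C
    & forall j : 'I_24, (j < 23)%N -> c 0 j = (u *m golay_gen) 0 j.
Proof.
pose R (c : 'rV_24) (v : 'rV['F_2]_12) :=
  [forall j : 'I_24, (j < 23)%N ==> (c 0 j == (v *m golay_gen) 0 j)].
have RP (c : 'rV_24) v : reflect
    (forall j : 'I_24, (j < 23)%N -> c 0 j = (v *m golay_gen) 0 j) (R c v).
  apply: (iffP forallP) => cv j; first by move/(implyP (cv j))/eqP.
  by apply/implyP => /cv/eqP.
(* By [C_golay] the default 0 is never taken on [C]. *)
pose g c := odflt 0 [pick v | R c v].
have gP c : c \in C -> R c (g c).
  case/C_golay=> v /RP cv; rewrite /g.
  by case: pickP => [w | /(_ v)/negP].
have g_inj : {in C &, injective g}.
  move=> c d Cc Cd eq_g; apply/eqP; rewrite -subr_eq0; apply/eqP.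
  apply: last_coord_inj (CB _ _ Cc Cd) _ => j ltj; rewrite !mxE.
  by rewrite (RP _ _ (gP c Cc)) // (RP _ _ (gP d Cd)) // eq_g subrr.
have : u \in g @: C.
  suff -> : g @: C = setT by rewrite inE.
  apply/eqP; rewrite eqEcard subsetT cardsT card_in_imset //.
  by rewrite card_mx card_Fp.
by case/imsetP => c Cc ->; exists c => //; apply/RP/gP.
Qed.

(** The lift of a generator row cannot end in 0, for it would have weight 7; so [C] contains the
    rows. Conversely, a word of [C] is determined by its first 23 coordinates. *)
Lemma transitive_code_golay : C = golay24.
Proof.
have C0 : 0 \in C.
  have [C0 | [c Cc]] := set_0Vmem C.
    by move: C_ge; rewrite C0 cards0 leqNgt expn_gt0.
  by have := CB c c Cc Cc; rewrite subrr.
have CN c : c \in C -> - c \in C by move=> Cc; rewrite -sub0r CB.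
have CD c d : c \in C -> d \in C -> c + d \in C.
  by move=> Cc Cd; rewrite -[d]opprK CB ?CN.
have C_row i : row i golay_gen \in C.
  have [c Cc Dc] := transitive_code_lift (delta_mx 0 i).
  suff -> : row i golay_gen = c by [].
  have {}Dc (j : 'I_24) : (j < 23)%N -> c 0 j = row i golay_gen 0 j.
    by move=> /Dc ->; rewrite -rowE.
  have row23 : row i golay_gen 0 ord_max = 1 by rewrite !mxE.
  apply/rowP => j; have [/Dc -> // | le23j] := ltnP j 23.
  rewrite (ge_ord_max _ j le23j).
  rewrite row23 [RHS]natF2; case: eqP => //= c23.
  have nz_c : c != 0.
    apply/eqP => c0.
    suff : (hweight (row i golay_gen) <= #|[set ord_max : 'I_24]|)%N.
      by rewrite hweight_golay_row cards1.
    apply/subset_leq_card/subsetP => k; rewrite !inE.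
    have [/Dc <- | le23k _] := ltnP k 23; first by rewrite c0 mxE eqxx.
    by rewrite (ge_ord_max _ k le23k).
  suff : (hweight c < hweight (row i golay_gen))%N.
    by rewrite hweight_golay_row ltnNge transitive_code_hweight.
  apply: proper_card.
  apply/properP; split.
    apply/subsetP => k; rewrite !inE.
    have [/Dc -> // | le23k] := ltnP k 23.
    rewrite (ge_ord_max _ k le23k).
    by rewrite c23 eqxx.
  by exists ord_max; rewrite !inE ?row23 ?c23 ?eqxx.
have C_gen u : u *m golay_gen \in C.
  rewrite mulmx_sum_row; elim/big_ind: _ => // i _.
  by rewrite [u 0 i]natF2; case: eqP => _; rewrite ?scale0r ?scale1r.
apply/setP => c; rewrite inE; apply/idP/submxP => [Cc | [u ->] //].
have [u Du] := C_golay c Cc; exists u; apply/eqP; rewrite -subr_eq0; apply/eqP.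
apply: last_coord_inj (CB _ _ Cc (C_gen u)) _ => j /Du; rewrite !mxE => ->.
by rewrite subrr.
Qed.

End TransitiveCode.

(** * Galois conjugates, 2-polynomials and separability *)

(** By irreducibility the minimal polynomial of [a] over [F] is associate to [f], so [b] is a root
    of it; normality of [K] provides the automorphism. *)
Lemma conjugate_roots (F : fieldType) (K : fieldExtType F) (f : {poly F}) a b :
    irreducible_poly f ->
    splittingFieldFor 1%VS (map_poly (in_alg K) f) {:K}%VS ->
    root (map_poly (in_alg K) f) a -> root (map_poly (in_alg K) f) b ->
  exists g : {rmorphism K -> K}, (forall k : F, g k%:A = k%:A) /\ g a = b.
Proof.
move=> irr_f split_f fa0 fb0.
have splitK : splitting_field_axiom K.
  by exists (map_poly (in_alg K) f); first exact: alg_polyOver.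
pose L : splittingFieldType F :=
  HB.pack K (FieldExt_isSplittingField.Build F K splitK).
have mb : root (minPoly (1%VS : {vspace L}) (a : L)) b.
  have /polyOver1P[q Dq] := minPolyOver 1%AS (a : L).
  have : minPoly (1%AS : {subfield L}) (a : L) %| map_poly (in_alg L) f.
    by apply: minPoly_dvdp => //; apply: alg_polyOver.
  rewrite Dq dvdp_map => q_f.
  have q_eq_f : q %= f.
    case: irr_f => _; apply=> //.
    by rewrite -(size_map_poly (in_alg L)) -Dq size_minPoly eqSS -lt0n.
  have /eqp_root-> // : map_poly (in_alg L) q %= map_poly (in_alg L) f.
  by rewrite eqp_map.
have [x x1 xa] := normalField_root_minPoly (sub1v _)
  (normalFieldf (1%AS : {subfield L})) (memvf (a : L)) mb.
exists (x : {rmorphism L -> L}); split=> // k.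
by apply: (fixed_gal (sub1v _) x1); rewrite rpredZ ?rpred1.
Qed.

(** Each ['X^(2 ^ i)] acts as an iterate of Frobenius. *)
Lemma two_poly_additive (F : fieldType) (K : fieldExtType F) (p : {poly F}) n :
    2 \in [pchar K] -> has_two_degree p n ->
  forall x y, (map_poly (in_alg K) p).[x + y] =
    (map_poly (in_alg K) p).[x] + (map_poly (in_alg K) p).[y].
Proof.
move=> ch2 [a [_ ->]] x y; rewrite rmorph_sum !horner_sum -big_split /=.
apply: eq_bigr => i _; rewrite map_polyZ map_polyXn !hornerZ !hornerXn.
rewrite -mulrDr; congr (_ * _).
elim: (i : nat) => [|k IHk]; first by rewrite !expr1.
by rewrite expnS mulnC !exprM IHk -!(pFrobenius_autE ch2) rmorphD.
Qed.

Lemma size_L24 : (size L24 <= (2 ^ 12).+1)%N.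
Proof.
have szX k : (k <= 12)%N -> (size ('X^(2 ^ k) : {poly F2t}) <= (2 ^ 12).+1)%N.
  by move=> lek; rewrite size_polyXn ltnS leq_exp2l.
have szZX a k :
    (k <= 12)%N -> (size (a *: 'X^(2 ^ k) : {poly F2t}) <= (2 ^ 12).+1)%N.
  by move=> lek; rewrite (leq_trans (size_scale_leq _ _)) ?szX.
have szD (p q : {poly F2t}) : (size p <= (2 ^ 12).+1 -> size q <= (2 ^ 12).+1 ->
    size (p + q)%R <= (2 ^ 12).+1)%N.
  by move=> szp szq; rewrite (leq_trans (size_polyD _ _)) // geq_max szp.
(* The trailing ['X] and ['X^2] are, by conversion, the cases [k = 0] and [k = 1]. *)
rewrite /L24; apply: (szD); last exact: (szZX _ 0%N).
apply: (szD); last exact: (szX 1%N).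
do 6! [apply: (szD); last exact: szZX].
exact: szX.
Qed.

(** The exponent 24 is even, so the derivative is 1 in characteristic 2. *)
Lemma f24_separable (K : fieldExtType F2t) :
  separable_poly (map_poly (in_alg K) f24).
Proof.
rewrite separable_map separable_poly.unlock.
suff -> : f24^`() = 1 by rewrite coprimep1.
have ch2 : 2 \in [pchar {poly F2t}].
  rewrite (rmorph_pchar polyC) // (rmorph_pchar (tofrac (R := {poly 'F_2}))) //.
  by rewrite (rmorph_pchar (polyC (R := 'F_2))) // pchar_Fp.
rewrite /f24 !derivD derivX derivC derivXn addr0 -[24%N]/(2 * 12)%N mulrnA.
by rewrite (mulrn_pchar ch2) mul0rn add0r.
Qed.

(** * The code of relations between the roots of [f24] *)

Section RelationCode.
Variables (K : fieldExtType F2t) (v : 'I_24 -> K).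

(** Relations are specialized from the ring of polynomials in [t], as evaluation at 0 does not
    extend to its fraction field. *)
Definition F2t_poly_emb : {rmorphism {poly 'F_2} -> K} :=
  in_alg K \o tofrac (R := {poly 'F_2}).

Definition F2_emb : {rmorphism 'F_2 -> K} := F2t_poly_emb \o polyC.

Lemma F2_embE a : F2_emb a = (a != 0)%:R.
Proof. by rewrite [in LHS](natF2 a) rmorph_nat. Qed.

Definition relation_value (c : 'rV['F_2]_24) := \sum_i F2_emb (c 0 i) * v i.

Definition relation_code : code 24 := [set c | relation_value c == 0].

Lemma relation_valueB c d :
  relation_value (c - d) = relation_value c - relation_value d.
Proof.
rewrite /relation_value -sumrB; apply: eq_bigr => i _.
by rewrite !mxE rmorphB mulrBl.
Qed.

Lemma relation_codeB c d :
  c \in relation_code -> d \in relation_code -> c - d \in relation_code.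
Proof. by rewrite !inE relation_valueB => /eqP-> /eqP->; rewrite subrr. Qed.

(** Each fibre of [relation_value] is empty or a translate of the code, and there are at most [m]
    nonempty ones. As [K] is not a finite type, values are numbered by their index in a list. *)
Lemma leq_card_relation_code m :
    (forall s : seq K,
      uniq s -> {subset s <= codom relation_value} -> size s <= m)%N ->
  (2 ^ 24 <= m * #|relation_code|)%N.
Proof.
move=> le_m; pose s := undup (codom relation_value).
have s_mem c : relation_value c \in s by rewrite mem_undup codom_f.
have s_idx c : (index (relation_value c) s < m)%N.
  rewrite (@leq_trans (size s)) ?index_mem ?s_mem //.
  by apply: le_m => [|y]; rewrite ?undup_uniq ?mem_undup.
pose idx c := Ordinal (s_idx c).
have <- : #|{: 'rV['F_2]_24}| = (2 ^ 24)%N by rewrite card_mx card_Fp.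
rewrite -[#|{: 'rV__}|]sum1_card (partition_big idx xpredT) //=.
apply: (@leq_trans (\sum_(y < m) #|relation_code|)%N); last first.
  by rewrite sum_nat_const card_ord.
apply: leq_sum => y _.
rewrite sum1_card.
have [d /eqP Dd | no_d] := pickP [pred c | idx c == y]; last first.
  by rewrite eq_card0.
rewrite -(card_imset _ (addIr (- d))) subset_leq_card //.
apply/subsetP => _ /imsetP[c /eqP Dc ->]; rewrite inE relation_valueB subr_eq0.
have eq_idx : index (relation_value c) s = index (relation_value d) s.
  exact: etrans Dc (congr1 val (esym Dd)).
by rewrite -(nth_index 0 (s_mem c)) eq_idx nth_index.
Qed.

(** The roots of a 2-polynomial are closed under addition, and the coefficients of a relation are 0
    or 1. *)
Lemma two_poly_relation_value p n c :
    has_two_degree p n -> (forall i, root (map_poly (in_alg K) p) (v i)) ->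
  root (map_poly (in_alg K) p) (relation_value c).
Proof.
move=> two_p v0; have addp := two_poly_additive _ _ _ _ (pchar2_ext K) two_p.
have p0 : root (map_poly (in_alg K) p) 0.
  by rewrite /root; have /eqP := addp 0 0; rewrite addr0 -subr_eq subrr eq_sym.
rewrite /relation_value; elim/big_ind: _ => // [x y /eqP px /eqP py | i _].
  by rewrite /root addp px py addr0.
rewrite F2_embE; case: eqP => _; rewrite ?mul0r //.
by rewrite mul1r.
Qed.

Hypothesis v_roots : map_poly (in_alg K) f24 = \prod_i ('X - (v i)%:P).

Lemma f24_root i : root (map_poly (in_alg K) f24) (v i).
Proof.
by rewrite v_roots (bigD1 i) //= /root hornerM hornerXsubC subrr mul0r.
Qed.

(** The [2 ^ 24] words take their values among the roots of [L24], of which there are at most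
    [2 ^ 12]. *)
Lemma relation_code_dim :
  minimal_two_poly f24 L24 -> (2 ^ 12 <= #|relation_code|)%N.
Proof.
case=> n [L_monic two_L f_L _].
have L_root i : root (map_poly (in_alg K) L24) (v i).
  have := f24_root i; rewrite -!dvdp_XsubCl => /dvdp_trans-> //.
  by rewrite dvdp_map.
rewrite -(leq_pmul2l (expn_gt0 2 12)) -expnD.
apply: leq_card_relation_code => s s_uniq s_val.
rewrite -ltnS (leq_trans _ size_L24) // -(size_map_poly (in_alg K)).
apply: max_poly_roots => //; first by rewrite map_poly_eq0 monic_neq0.
by apply/allP => y /s_val/codomP[c ->]; apply: two_poly_relation_value two_L _.
Qed.

Lemma f24_roots_inj : injective v.
Proof.
apply/injectiveP; rewrite /injectiveb /dinjectiveb.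
have := f24_separable K; rewrite v_roots.
by rewrite -(big_map v xpredT (fun x => 'X - x%:P)) separable_prod_XsubC enumT.
Qed.

(** Automorphisms of [K] over [F2t] permute the roots and fix the coefficients of relations. *)
Lemma relation_code_trans i j :
    irreducible_poly f24 ->
    splittingFieldFor 1%VS (map_poly (in_alg K) f24) {:K}%VS ->
  exists s : 'S_24,
    s i = j /\ {in relation_code, forall c, col_perm s c \in relation_code}.
Proof.
move=> irr_f split_f.
have [g [g_fix gji]] :=
  conjugate_roots _ _ _ _ _ irr_f split_f (f24_root j) (f24_root i).
have g_root k : exists l, g (v k) == v l.
  have : root (map_poly (in_alg K) f24) (g (v k)).
    have -> : map_poly (in_alg K) f24 = map_poly g (map_poly (in_alg K) f24).
      by rewrite -map_poly_comp; apply: eq_map_poly => a /=; rewrite g_fix.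
    by rewrite /root horner_map (eqP (f24_root k)) rmorph0.
  rewrite v_roots -(big_map v xpredT (fun x => 'X - x%:P)) root_prod_XsubC.
  by case/mapP => l _ ->; exists l.
pose r k := xchoose (g_root k).
have rP k : g (v k) = v (r k) by apply/eqP/(xchooseP (g_root k)).
have r_inj : injective r.
  by move=> k l /(congr1 v); rewrite -!rP => /fmorph_inj/f24_roots_inj.
(* Applying [g] moves the coefficient at [k] to [r k], while [col_perm s] reads the coefficient at
   [s k]: hence the inverse, and a [g] that sends [v j] to [v i]. *)
exists (perm r_inj)^-1%g; split.
  by apply: (canLR (permK _)); rewrite permE; apply: f24_roots_inj; rewrite -rP.
move=> c; rewrite !inE => /eqP c0; apply/eqP; rewrite -(rmorph0 g) -c0.
rewrite rmorph_sum [LHS](reindex_inj (@perm_inj _ (perm r_inj))).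
apply: eq_bigr => k _; rewrite rmorphM /= g_fix mxE permK rP.
by rewrite permE.
Qed.

Lemma relation_code_golay :
    irreducible_poly f24 -> minimal_two_poly f24 L24 ->
    splittingFieldFor 1%VS (map_poly (in_alg K) f24) {:K}%VS ->
  code_equiv relation_code golay24.
Proof.
move=> irr_f min_L split_f; have [L [z gz0]] := golay_root_exists.
pose w (i : 'I_24) := if (i < 23)%N then z ^+ i else 0.
(* The inner ['X] stands for [t]: [F2t_poly_emb] turns [F] into [f24], and [h], which sets [t] to 0,
   turns it into ['X^24 + 'X]. *)
pose F : {poly {poly 'F_2}} := 'X^24 + 'X + 'X%:P.
pose h : {rmorphism {poly 'F_2} -> L} := in_alg L \o horner_eval 0.
pose rel (c : 'rV['F_2]_24) : {mpoly {poly 'F_2}[24]} :=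
  \sum_i (c 0 i)%:P *: 'X_i.
have eval_rel (S : comNzRingType) (e : {rmorphism {poly 'F_2} -> S}) u c :
    mmap e u (rel c) = \sum_i e (c 0 i)%:P * u i.
  rewrite rmorph_sum; apply: eq_bigr => i _ /=.
  by rewrite mmapZ mmapX mmap1U.
have [||||s rel_s] := specialize_roots _ _ _ _ F2t_poly_emb h F v w
  [seq rel c | c <- enum relation_code].
- by move=> p q /fmorph_inj/eqP; rewrite tofrac_eq => /eqP.
- by rewrite -v_roots /f24 !rmorphD /= !map_polyXn !map_polyX !map_polyC.
- rewrite -(map_X24_X_golay _ _ _ gz0) !rmorphD /= !map_polyXn !map_polyX.
  by rewrite map_polyC /= /horner_eval hornerX scale0r addr0.
- move=> _ /mapP[c Cc ->]; rewrite eval_rel.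
  by move: Cc; rewrite mem_enum inE => /eqP.
(* Specialization matches [v i] with [w (s i)], so coordinates are reindexed by the inverse of [s]
   to follow [w]. *)
exists s^-1%g; apply/esym/transitive_code_golay.
- rewrite card_imset ?relation_code_dim //.
  by apply: (can_inj (g := col_perm s)) => c; rewrite -col_permM mulgV col_perm1.
- move=> _ _ /imsetP[c Cc ->] /imsetP[d Cd ->]; rewrite -linearB.
  by rewrite imset_f // relation_codeB.
- move=> _ /imsetP[c Cc ->]; apply: (golay_root_relation _ _ _ gz0).
  have /rel_s : rel c \in [seq rel c | c <- enum relation_code].
    by rewrite map_f ?mem_enum.
  rewrite eval_rel => c0; rewrite -[RHS]c0.
  rewrite (reindex_inj (@perm_inj _ s)); apply: eq_bigr => i _.
  by rewrite mxE permK /= /horner_eval hornerC.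
(* Transitivity is transported to the reindexed code by conjugation with [s]. *)
move=> i j.
have [r [rij Cr]] := relation_code_trans (s^-1 i)%g (s^-1 j)%g irr_f split_f.
exists (s^-1 * (r * s))%g; split; first by rewrite !permM rij permKV.
move=> _ /imsetP[c Cc ->]; rewrite -col_permM; apply/imsetP.
exists (col_perm r c); first exact: Cr.
by rewrite -col_permM -!mulgA mulgV mulg1.
Qed.

End RelationCode.

Theorem lemma24
  (f_irreducible : irreducible_poly f24)
  (L_minimal : minimal_two_poly f24 L24)
  (L_factors : irreducible_factor_degrees L24 [:: 1; 24; 276; 1771; 2024]%N)
  (K : fieldExtType F2t)
  (K_splitting : splittingFieldFor 1%VS (map_poly (in_alg K) f24) {:K}%VS)
  (beta : 'I_24 -> over_F2 K)
  (beta_roots : map_poly (in_alg K) f24 =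
                \prod_(i < 24) ('X - (beta i : K)%:P))
  (W : vectType 'F_2) (w : 24.-tuple W) (w_basis : basis_of {:W}%VS w)
  (psi : {linear W -> F2span beta})
  (psi_w : forall i : 'I_24, F2span_val (psi (tnth w i)) = beta i) :
  code_equiv (kernel_code w psi) golay24.
Proof.
suff -> : kernel_code w psi = relation_code K beta.
  exact: relation_code_golay beta_roots f_irreducible L_minimal K_splitting.
apply/setP => c; rewrite !inE -val_eqE.
suff -> : val (psi (\sum_i c 0 i *: tnth w i)) = relation_value K beta c by [].
rewrite !linear_sum; apply: eq_bigr => i _.
(* The scalar action on [over_F2 K] and [F2_emb] are built differently; they are compared on the
   coefficients 0 and 1. *)
rewrite F2_embE !linearZ /= psi_w [c 0 i in LHS]natF2 scaler_nat.
by case: eqP => _; rewrite ?mul0r ?mul1r.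
Qed.
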